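(* For $n\ge1$ let $C_n=(V_n,E_n)$ be the hypercube graph with $V_n=\{0,1\}^n$ and $E_n=\{\{u,v\}\subseteq V_n : \|u-v\|_1=1\}$, and let $P_n$ be the transition matrix on $V_n$ with $P_n(u,v)=\frac1n$ if $\|u-v\|_1=1$ and $P_n(u,v)=0$ otherwise. Let $\mathcal D_{\mathrm C}=(\mathfrak d,G,P)$ be the random walk on a growing graph with $G(n)=C_n$ and $P(n)=P_n$, started at the origin $\mathbf 0$. If $$\sum_{n=1}^\infty\frac{\mathfrak d(n)}{2^n}=\infty$$ then $\mathbf 0$ is recurrent by $\mathcal D_{\mathrm C}$; otherwise $\mathbf 0$ is transient by $\mathcal D_{\mathrm C}$.
   Context: Random walk on a growing graph (RWoGG). A RWoGG is a triple $\mathcal D=(\mathfrak d,G,P)$, where $\mathfrak d:\mathbb Z_{>0}\to\mathbb Z_{\ge0}$ (the duration), $G(n)=(V(n),E(n))$ is a finite simple undirected graph for each $n\ge1$ with $V(n)\subseteq V(n+1)$ and $E(n)\subseteq E(n+1)$, and $P(n)$ is a stochastic matrix on $V(n)$ (transition probabilities of a random walk on $G(n)$). Put $T_0=0$ and $T_n=\sum_{i=1}^n\mathfrak d(i)$; it is assumed that $T_n\to\infty$, so that the walk is defined at all times. The walk $X_0,X_1,X_2,\dots$ started at $v\in V(1)$ is the Markov process with $X_0=v$ in which the transition from $X_t$ to $X_{t+1}$ follows $P(n)$ whenever $T_{n-1}\le t<T_n$. Let $R(t)=\Pr[X_t=v]$. The vertex $v$ is recurrent by $\mathcal D$ if $\sum_{t=1}^\infty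 R(t)=\infty$, and transient by $\mathcal D$ otherwise. The inclusion $V_n\subseteq V_{n+1}$ is given by identifying $(u_1,\dots,u_n)\in\{0,1\}^n$ with $(u_1,\dots,u_n,0)\in\{0,1\}^{n+1}$; $\mathbf 0=(0,\dots,0)$ is the common origin of all $V_n$. *)

(* Defs.v *)
From HB Require Import structures.
From mathcomp Require Import all_boot all_order all_algebra.
From mathcomp Require Import all_classical all_reals all_analysis.
Set Implicit Arguments.
Unset Strict Implicit.
Unset Printing Implicit Defensive.
Import Order.TTheory GRing.Theory Num.Theory.
Import numFieldNormedType.Exports.

Local Open Scope classical_set_scope.
Local Open Scope ring_scope.

(* All the graphs of a growing sequence have their vertices in one ambient
   type [U]. *)
Record sgraph (U : choiceType) := SGraph {
  vertices : set U;
  adj : U -> U -> Prop;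
  vertices_finite : finite_set vertices;
  adj_vertices : forall u v, adj u v -> vertices u /\ vertices v;
  adj_sym : forall u v, adj u v -> adj v u;
  adj_irrefl : forall u, ~ adj u u }.

Definition subgraph (U : choiceType) (G H : sgraph U) : Prop :=
  vertices G `<=` vertices H /\ (forall u v, adj G u v -> adj H u v).

Definition stochastic_on (R : realType) (U : choiceType) (V : set U)
    (p : U -> U -> R) : Prop :=
  (forall u v, V u -> V v -> 0 <= p u v) /\
  (forall u, V u -> \sum_(v \in V) p u v = 1).

Definition phase_end (dur : nat -> nat) (n : nat) : nat :=
  (\sum_(1 <= i < n.+1) dur i)%N.

(* The sequences are indexed by n >= 1; their values at 0 play no role. *)
Record rwogg (R : realType) (U : choiceType) := RWoGG {
  duration : nat -> nat;
  graph : nat -> sgraph U;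
  trans : nat -> U -> U -> R;
  graph_grows : forall n, (0 < n)%N -> subgraph (graph n) (graph n.+1);
  trans_stochastic : forall n, (0 < n)%N ->
    stochastic_on (vertices (graph n)) (trans n);
  phase_end_infty : phase_end duration n @[n --> \oo] --> \oo }.

Section Walk.
Context {R : realType} {U : choiceType} {d : measure_display}
  {Omega : measurableType d}.
Implicit Types (D : rwogg R U) (Pr : probability Omega R)
  (X : nat -> Omega -> U) (v : U).

Definition trajectory X (t : nat) (x : nat -> U) : set Omega :=
  [set w | forall i, (i <= t)%N -> X i w = x i].

(* [walk_step] is the Markov property together with the transition
   probabilities: conditionally on the whole past, X_{t+1} has law
   P(n)(X_t, .) when T_{n-1} <= t < T_n.  It is stated multiplicatively, to
   avoid conditioning on null events. *)
Record is_walk D v Pr X : Prop := IsWalk {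
  walk_origin : vertices (graph D 1) v;
  walk_measurable : forall t u, measurable (X t @^-1` [set u]);
  walk_start : Pr (X 0%N @^-1` [set v]) = 1%E;
  walk_step : forall n t (x : nat -> U), (0 < n)%N ->
    (phase_end (duration D) n.-1 <= t < phase_end (duration D) n)%N ->
    vertices (graph D n) (x t) -> vertices (graph D n) (x t.+1) ->
    Pr (trajectory X t.+1 x) =
      (Pr (trajectory X t x) * (trans D n (x t) (x t.+1))%:E)%E }.

Definition return_prob Pr X v (t : nat) : \bar R := Pr (X t @^-1` [set v]).

Definition recurrent Pr X v : Prop :=
  (\sum_(1 <= t <oo) return_prob Pr X v t = +oo)%E.

Definition transient Pr X v : Prop := ~ recurrent Pr X v.

End Walk.

(* A vertex (u_1, ..., u_n) of the n-cube is encoded by the infinite sequence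
   u_1, ..., u_n, 0, 0, ..., which realizes the identification of
   (u_1, ..., u_n) with (u_1, ..., u_n, 0). *)
Definition pad (n : nat) (u : n.-tuple bool) : nat -> bool := nth false u.

Lemma pad_rcons n (u : n.-tuple bool) : pad [tuple of rcons u false] = pad u.
Proof.
apply/funext => i; rewrite /pad nth_rcons size_tuple.
case: ltngtP => // [lt_ni|->]; rewrite nth_default ?size_tuple //.
exact: ltnW.
Qed.

Lemma pad_inj n : injective (@pad n).
Proof.
move=> u v uv; apply/val_inj/(@eq_from_nth _ false); rewrite ?size_tuple//.
by move=> i _; exact: (congr1 (@^~ i) uv).
Qed.

Definition cube (n : nat) : set (nat -> bool) := range (@pad n).

Definition l1dist (n : nat) (u v : nat -> bool) : nat :=
  (\sum_(i < n) `|(u i)%:Z - (v i)%:Z|)%N.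

Definition cube_adj (n : nat) (u v : nat -> bool) : Prop :=
  [/\ cube n u, cube n v & l1dist n u v = 1%N].

Definition cube_trans (R : realType) (n : nat) (u v : nat -> bool) : R :=
  if l1dist n u v == 1%N then n%:R^-1 else 0.

Definition cube_origin : nat -> bool := fun=> false.

Lemma l1distC n u v : l1dist n u v = l1dist n v u.
Proof. by apply: eq_bigr => i _; rewrite distnC. Qed.

Lemma l1distnn n u : l1dist n u u = 0%N.
Proof. by apply: big1 => i _; rewrite distnn. Qed.

Lemma cube_default n u i : cube n u -> (n <= i)%N -> u i = false.
Proof. by case=> t _ <- ni; rewrite /pad nth_default ?size_tuple. Qed.

Lemma l1distS n u v : cube n u -> cube n v -> l1dist n.+1 u v = l1dist n u v.
Proof.
move=> /cube_default cu /cube_default cv.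
by rewrite /l1dist big_ord_recr/= (cu n)// (cv n)// addn0.
Qed.

Lemma cubeS n : cube n `<=` cube n.+1.
Proof. by move=> _ [u _ <-]; exists [tuple of rcons u false] => //; exact: pad_rcons. Qed.

Lemma cube_finite n : finite_set (cube n).
Proof. by apply: finite_image; exact: finite_finset. Qed.

Lemma cube_adj_sym n u v : cube_adj n u v -> cube_adj n v u.
Proof. by case=> cu cv uv; split=> //; rewrite l1distC. Qed.

Lemma cube_adj_irrefl n u : ~ cube_adj n u u.
Proof. by case=> _ _; rewrite l1distnn. Qed.

Lemma cube_adj_vertices n u v : cube_adj n u v -> cube n u /\ cube n v.
Proof. by case. Qed.

Definition cube_graph (n : nat) : sgraph (nat -> bool) :=
  SGraph (cube_finite n) (@cube_adj_vertices n) (@cube_adj_sym n)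
    (@cube_adj_irrefl n).

Lemma cube_grows n : (0 < n)%N -> subgraph (cube_graph n) (cube_graph n.+1).
Proof.
move=> _; split=> [|u v [cu cv uv]]; first exact: cubeS.
by split; [exact: cubeS|exact: cubeS|rewrite l1distS].
Qed.

Definition flip n (u : n.-tuple bool) (i : 'I_n) : n.-tuple bool :=
  [tuple tnth u j (+) (j == i) | j < n].

Lemma l1dist_pad n (u v : n.-tuple bool) :
  l1dist n (pad u) (pad v) = #|[set i | tnth u i != tnth v i]%SET|.
Proof.
rewrite -sum1dep_card big_mkcond /=; apply: eq_bigr => i _.
rewrite /pad -!tnth_nth.
by case: (tnth u i); case: (tnth v i).
Qed.

Lemma flip_inj n (u : n.-tuple bool) : injective (flip u).
Proof.
move=> i j /(congr1 (fun w => tnth w i)); rewrite !tnth_mktuple eqxx.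
by move=> /addbI/esym/eqP.
Qed.

Lemma l1dist_eq1 n (u v : n.-tuple bool) :
  (l1dist n (pad u) (pad v) == 1%N) = (v \in [set flip u i | i : 'I_n]%SET).
Proof.
rewrite l1dist_pad; apply/cards1P/imsetP => [[i Si]|[i _ ->]]; exists i => //.
  apply/eq_from_tnth => j; rewrite tnth_mktuple.
  move/setP: Si => /(_ j); rewrite !inE => <-.
  by case: (tnth u j); case: (tnth v j).
apply/setP => j; rewrite !inE tnth_mktuple.
by case: (tnth u j); case: (j == i).
Qed.

Lemma cube_trans_stochastic (R : realType) n : (0 < n)%N ->
  stochastic_on (vertices (cube_graph n)) (@cube_trans R n).
Proof.
move=> n0; split=> [u v _ _|_ [u _ <-]].
  by rewrite /cube_trans; case: ifP => // _; rewrite invr_ge0.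
rewrite /= /cube fsbig_image; last by move=> ? ? _ _; exact: pad_inj.
rewrite (_ : setT = [set` enum {: n.-tuple bool}]); last first.
  by apply/seteqP; split=> t //= _; rewrite mem_enum.
rewrite -fsbig_seq ?enum_uniq// big_enum/=.
under eq_bigr do rewrite /cube_trans l1dist_eq1.
rewrite -big_mkcond/= sumr_const card_imset; last exact: flip_inj.
by rewrite card_ord -[_ *+ n]mulr_natr mulVf// pnatr_eq0 -lt0n.
Qed.

Definition cube_rwogg (R : realType) (dur : nat -> nat)
    (dur_infty : phase_end dur n @[n --> \oo] --> \oo) :
    rwogg R (nat -> bool) :=
  RWoGG cube_grows (@cube_trans_stochastic R) dur_infty.

(* Main.v *)
Require Import Defs.
From HB Require Import structures.
From mathcomp Require Import all_boot all_order all_algebra.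
From mathcomp Require Import all_classical all_reals all_analysis.
From mathcomp Require Import zify ring lra.
Import Order.TTheory GRing.Theory Num.Theory.
Import numFieldNormedType.Exports.

Local Open Scope classical_set_scope.
Local Open Scope ring_scope.

(** Write the walk as a sum in (Z/2)^N: the step at time s adds a uniform basis
    vector among the first n_s ones, where n_s is the phase of time s.  The
    steps are independent, so the Fourier transform on (Z/2)^N diagonalizes all
    of them at once, although the dimension changes with time:
      R(t) = E [ \prod_(s < t) a_(n_s) ],
    where e_0, e_1, ... are fair coin tosses (a uniform character of the cube)
    and a_n = (1/n) \sum_(i < n) (-1)^(e_i) is the eigenvalue of the step
    matrix P_n at that character ([return_from_mean], transported to the
    process by [return_probE]).

    The eigenvalue a_k equals 1 when the first k tosses all vanish, -1 when they
    are all one, and otherwise |a_k| <= 1 - 1/k ([bias_mixed]).  The two extreme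
    cases have probability 2^-k each; they are the contribution of the
    stationary measure and of the bipartite parity.

    Recurrence.  After k^2 steps inside phase k the mixed characters contribute
    at most (1 - 1/k)^(k^2) <= 2^-k, while at even times the two extreme ones
    contribute 2 * 2^-k.  So R(t) >= 2^-k at the even times of phase k beyond the
    first k^2 ([return_at_ge]).  The sum of R over phase k is then at least about
    d(k) / 2^(k+1), up to a correction of order k^2 / 2^k, which is summable
    ([block_lower]).

    Transience.  The times are grouped by the phase of six steps earlier: the
    probabilities summed are R(t + 6) for t in phase k ([block_upper]).  The last
    six steps then take place in cubes of dimension at least k, and since
    E a_n^6 <= 15 / n^3 this alone gives R(t + 6) <= 15 / k^3
    ([return_at_le_cube]); it takes care of the first six steps of the phase,
    however short the previous phases were.  Later in the phase
    R(t + 6) <= E |a_k|^m after m >= 6 steps, and the geometric sum over m is at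
    most k a_k^6 on mixed characters and d(k) on the extreme ones.  Phase k
    contributes at most 105 / k^2 + 2 d(k) / 2^k in all. *)

Set Implicit Arguments.
Unset Strict Implicit.
Unset Printing Implicit Defensive.

(** * Means over fair coin tosses *)

Section CoinTosses.
Context {R : realType}.
Implicit Types (f g : (nat -> bool) -> R) (e : nat -> bool) (n N : nat).

Definition set_bit e n (b : bool) : nat -> bool :=
  fun i => if i == n then b else e i.

(** The mean of [f] over the first [N] tosses, the later ones being set to
    [false].  Integrating out the last toss first makes every property below a
    one-line induction and avoids indexing by the vertices of a cube. *)
Fixpoint mean N f : R :=
  if N is N'.+1 then
    (mean N' (fun e => f (set_bit e N' false))
     + mean N' (fun e => f (set_bit e N' true))) / 2
  else f (fun=> false).

Lemma eq_mean N f g : f =1 g -> mean N f = mean N g.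
Proof. by move=> /funext ->. Qed.

Lemma mean_cst N (c : R) : mean N (fun=> c) = c.
Proof. by elim: N => //= N ->; field. Qed.

Lemma meanD N f g : mean N (fun e => f e + g e) = mean N f + mean N g.
Proof. by elim: N f g => //= N IH f g; rewrite !IH; ring. Qed.

Lemma meanZ N (c : R) f : mean N (fun e => c * f e) = c * mean N f.
Proof. by elim: N f => //= N IH f; rewrite !IH; ring. Qed.

Lemma mean_sum N (I : Type) (r : seq I) (F : I -> (nat -> bool) -> R) :
  mean N (fun e => \sum_(i <- r) F i e) = \sum_(i <- r) mean N (F i).
Proof.
elim: r => [|i r IH]; first by under eq_mean do rewrite big_nil;
  rewrite mean_cst big_nil.
by under eq_mean do rewrite big_cons; rewrite meanD IH big_cons.
Qed.

Lemma mean_le N f g : (forall e, f e <= g e) -> mean N f <= mean N g.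
Proof.
elim: N f g => //= N IH f g fg.
by rewrite ler_pM2r ?invr_gt0 ?ltr0n// lerD// IH.
Qed.

Lemma mean_local n N f : (n <= N)%N ->
  (forall e e', (forall i, (i < n)%N -> e i = e' i) -> f e = f e') ->
  mean N f = mean n f.
Proof.
move=> nN loc; elim: N nN => [|N IH]; first by case: n loc.
rewrite leq_eqVlt => /predU1P[->//|nN].
have bit b : mean N (fun e => f (set_bit e N b)) = mean n f.
  rewrite -IH//; apply: eq_mean => e; apply: loc => i ni.
  by rewrite /set_bit; case: eqP => // iN; rewrite iN ltnNge -ltnS nN in ni.
by rewrite /= !bit; field.
Qed.

(** Independence of the tosses. *)
Lemma mean_prod N (F : nat -> bool -> R) :
  mean N (fun e => \prod_(i < N) F i (e i)) =
  \prod_(i < N) ((F i false + F i true) / 2).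
Proof.
elim: N => [|N IH] /=; first by rewrite !big_ord0.
have bit b : mean N (fun e => \prod_(i < N.+1) F i (set_bit e N b i)) =
    F N b * mean N (fun e => \prod_(i < N) F i (e i)).
  rewrite -meanZ; apply: eq_mean => e.
  rewrite big_ord_recr /= {2}/set_bit eqxx mulrC; congr (_ * _).
  by apply: eq_bigr => i _; rewrite /set_bit ltn_eqF.
by rewrite !bit IH big_ord_recr /=; ring.
Qed.

Definition signsum n e : R := \sum_(i < n) (-1) ^+ e i.

(** The eigenvalue of the step matrix of the [n]-cube at the character [e]. *)
Definition bias n e : R := signsum n e / n%:R.

Lemma signsum_local n e e' :
  (forall i, (i < n)%N -> e i = e' i) -> signsum n e = signsum n e'.
Proof. by move=> ee'; apply: eq_bigr => i _; rewrite ee'. Qed.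

(** A toss independent of the previous ones moves the sum by 1 or -1. *)
Lemma mean_signsumS n (p : R -> R) :
  mean n.+1 (fun e => p (signsum n.+1 e)) =
  (mean n (fun e => p (signsum n e + 1)) +
   mean n (fun e => p (signsum n e - 1))) / 2.
Proof.
have bit e b : signsum n.+1 (set_bit e n b) = signsum n e + (-1) ^+ b.
  rewrite /signsum big_ord_recr /= {2}/set_bit eqxx; congr (_ + _).
  by apply: eq_bigr => i _; rewrite /set_bit ltn_eqF.
by congr ((_ + _) / 2); apply: eq_mean => e; rewrite bit.
Qed.

(** The even moments obey a recursion in [n] because averaging over the new sign
    kills the odd powers: for instance (s + 1)^6 and (s - 1)^6 have mean
    s^6 + 15 s^4 + 15 s^2 + 1. *)
Lemma signsum_moments n :
  [/\ mean n (fun e => signsum n e ^+ 2) = n%:R,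
      mean n (fun e => signsum n e ^+ 4) = 3 * n%:R ^+ 2 - 2 * n%:R
    & mean n (fun e => signsum n e ^+ 6) =
        15 * n%:R ^+ 3 - 30 * n%:R ^+ 2 + 16 * n%:R].
Proof.
elim: n => [|n [M2 M4 M6]].
  by split; rewrite /= /signsum big_ord0 !expr0n /=; ring.
have step p q : (forall s, (p (s + 1) + p (s - 1)) / 2 = q s) ->
    mean n.+1 (fun e => p (signsum n.+1 e)) = mean n (fun e => q (signsum n e)).
  move=> pq; rewrite mean_signsumS -meanD mulrC -meanZ.
  by apply: eq_mean => e; rewrite mulrC pq.
split.
- rewrite (step (fun s => s ^+ 2) (fun s => s ^+ 2 + 1)); last by move=> s; field.
  by rewrite meanD mean_cst M2 -natr1; ring.
- rewrite (step (fun s => s ^+ 4) (fun s => s ^+ 4 + (6 * s ^+ 2 + 1))).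
    by rewrite !meanD meanZ mean_cst M2 M4 -natr1; ring.
  by move=> s; field.
- rewrite (step (fun s => s ^+ 6)
    (fun s => s ^+ 6 + (15 * s ^+ 4 + (15 * s ^+ 2 + 1)))).
    by rewrite !meanD !meanZ mean_cst M2 M4 M6 -natr1; ring.
  by move=> s; field.
Qed.

Lemma mean_bias6 n N : (0 < n)%N -> (n <= N)%N ->
  mean N (fun e => bias n e ^+ 6) <= 15 / n%:R ^+ 3.
Proof.
move=> n0 nN; have nR : 1 <= n%:R :> R by rewrite ler1n.
rewrite (@mean_local n) //; last first.
  by move=> e e' ee'; rewrite /bias (signsum_local ee').
under eq_mean do rewrite /bias exprMn mulrC.
rewrite meanZ; have [_ _ ->] := signsum_moments n.
rewrite exprVn mulrC ler_pdivrMr ?exprn_gt0 ?(lt_le_trans ltr01)//.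
have -> : 15 / n%:R ^+ 3 * n%:R ^+ 6 = 15 * n%:R ^+ 3 :> R.
  by field; rewrite gt_eqF// (lt_le_trans ltr01).
nra.
Qed.

Lemma bias_le1 n e : `|bias n e| <= 1.
Proof.
rewrite /bias normrM normfV normr_nat; case: n => [|n].
  by rewrite invr0 mulr0.
rewrite ler_pdivrMr ?ltr0n// mul1r (le_trans (ler_norm_sum _ _ _))//.
under eq_bigr do rewrite normrX normrN1 expr1n.
by rewrite sumr_const card_ord.
Qed.

Definition constant_at (b : bool) n e : bool := [forall i : 'I_n, e i == b].

Lemma bias_constant b n e : (0 < n)%N -> constant_at b n e -> bias n e = (-1) ^+ b.
Proof.
move=> n0 /forallP eb; rewrite /bias /signsum.
under eq_bigr do rewrite (eqP (eb _)).
by rewrite sumr_const card_ord -[_ *+ n]mulr_natr mulfK// pnatr_eq0 -lt0n.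
Qed.

(** Opposite signs cancel, so two of the [n] terms drop out; one of the two
    units saved is given up, which keeps the bound nonnegative at [n = 1]. *)
Lemma bias_mixed n e : ~~ constant_at false n e -> ~~ constant_at true n e ->
  `|bias n e| <= 1 - n%:R^-1.
Proof.
move=> /forallPn[i]; rewrite eqbF_neg negbK => ei /forallPn[j].
rewrite eqb_id => ej.
have n0 : 0 < n%:R :> R by rewrite ltr0n (leq_ltn_trans _ (ltn_ord i)).
have ij : j != i by apply: contraNneq ej => ->.
rewrite /bias normrM normfV normr_nat ler_pdivrMr// mulrBl mul1r mulVf ?gt_eqF//.
(* the toss [i] contributes -1 and the toss [j] contributes 1 *)
rewrite /signsum (bigD1 i)//= (bigD1 j)//= ei (negbTE ej) expr1 expr0 addrA addNr add0r.
rewrite (le_trans (ler_norm_sum _ _ _))//.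
under eq_bigr do rewrite normrX normrN1 expr1n.
rewrite sumr_const lerBrDr natr1 ler_nat.
rewrite -[X in (_ < X)%N](card_ord n); apply/proper_card/properP.
by split; [apply/fintype.subsetP | exists i => //; rewrite unfold_in /= eqxx].
Qed.

Lemma mean_constant b n N : (n <= N)%N ->
  mean N (fun e => (constant_at b n e)%:R) = 2^-1 ^+ n.
Proof.
move=> nN; rewrite (@mean_local n)//; last first.
  by move=> e e' ee'; congr (_%:R); congr nat_of_bool;
     apply: eq_forallb => i; rewrite ee'.
transitivity (mean n (fun e => \prod_(i < n) (e i == b)%:R)).
  apply: eq_mean => e; case: (boolP (constant_at b n e)) => [/forallP eb|].
    by rewrite big1// => i _; rewrite eb.
  by move=> /forallPn[i /negbTE eib]; rewrite (bigD1 i)//= eib mul0r.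
rewrite (mean_prod n (fun=> fun c => (c == b)%:R)) /= prodr_const card_ord.
by case: b; rewrite ?addr0 ?add0r mul1r.
Qed.

End CoinTosses.

(** * Return probabilities as means of products of eigenvalues *)

Section ReturnProbability.
Context {R : realType}.
Implicit Types (u e : nat -> bool) (n N : nat) (ns : seq nat).

Definition flip_coord u (i : nat) : nat -> bool := fun j => u j (+) (j == i).

(** The probability that the walk started at [u], whose successive steps take
    place in cubes of the dimensions listed in [ns], ends at the origin. *)
Fixpoint return_from ns u : R :=
  if ns is n :: ns' then
    n%:R^-1 * \sum_(i < n) return_from ns' (flip_coord u i)
  else (u == cube_origin)%:R.

Lemma return_from_ge0 ns u : 0 <= return_from ns u.
Proof.
elim: ns u => [|n ns IH] u /=; first exact: ler0n.
by rewrite mulr_ge0 ?invr_ge0 ?ler0n// sumr_ge0.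
Qed.

(** Fourier inversion: flipping coordinate [i] of [u] multiplies the character
    of [u] by (-1)^(e i), so a step multiplies the transform by the eigenvalue
    [bias n e]; for the empty list the mean of the character is the indicator
    function of the origin. *)
Lemma return_from_mean N ns u : (forall i, (N <= i)%N -> u i = false) ->
  all (fun n => n <= N)%N ns ->
  return_from ns u =
  mean N (fun e => (\prod_(i < N) (-1) ^+ (e i && u i))
                   * \prod_(n <- ns) bias n e).
Proof.
elim: ns u => [|n ns IH] u uN /=.
  move=> _; under eq_mean do rewrite big_nil mulr1.
  rewrite (mean_prod N (fun i b => (-1) ^+ (b && u i))) /=.
  case: eqP => [->|u0]; first by rewrite big1// => i _; rewrite /= expr0; field.
  have [i ui] : exists i : 'I_N, u i.
    apply: contrapT => noi; apply: u0; apply/funext => i; rewrite /cube_origin.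
    have [iN|/uN//] := ltnP i N.
    by apply/negbTE/negP => ui; apply: noi; exists (Ordinal iN).
  by rewrite (bigD1 i)//= ui expr0 expr1 subrr mul0r mul0r.
move=> /andP[nN nsN].
transitivity (n%:R^-1 * \sum_(i < n) mean N (fun e =>
    (\prod_(j < N) (-1) ^+ (e j && u j)) * (\prod_(m <- ns) bias m e)
    * (-1) ^+ e i) : R).
  congr (_ * _); apply: eq_bigr => i _; rewrite IH//; last first.
    move=> j Nj; rewrite /flip_coord uN//= gtn_eqF//.
    by rewrite (leq_trans _ Nj)// (leq_trans (ltn_ord i)).
  apply: eq_mean => e; rewrite mulrAC; congr (_ * _).
  have iN : (i < N)%N := leq_trans (ltn_ord i) nN.
  rewrite (bigD1 (Ordinal iN))//= [X in _ = X * _](bigD1 (Ordinal iN))//=.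
  rewrite mulrAC /flip_coord eqxx; congr (_ * _).
    by case: (e i); case: (u i); rewrite /= !(expr0, expr1); ring.
  by apply: eq_bigr => j ji; rewrite (_ : (j == i :> nat) = false) ?addbF//;
     apply/negbTE.
rewrite -mean_sum -meanZ; apply: eq_mean => e.
by rewrite -mulr_sumr big_cons /bias /signsum; ring.
Qed.

End ReturnProbability.

(** * The phases of a growing walk *)

Section Phases.
Variable dur : nat -> nat.
Hypothesis dur_infty : phase_end dur n @[n --> \oo] --> \oo.

Lemma phase_endS n : phase_end dur n.+1 = (phase_end dur n + dur n.+1)%N.
Proof. by rewrite /phase_end big_nat_recr. Qed.

Lemma phase_end0 : phase_end dur 0 = 0%N.
Proof. by rewrite /phase_end big_geq. Qed.

Lemma leq_phase_end m n : (m <= n)%N -> (phase_end dur m <= phase_end dur n)%N.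
Proof.
move=> /subnK <-; elim: (n - m)%N => //= k IH.
by rewrite addSn phase_endS (leq_trans IH)// leq_addr.
Qed.

Lemma phase_end_gt t : exists n, (t < phase_end dur n)%N.
Proof.
have /cvgnyPgt/(_ t)[n _ tn] := dur_infty.
by exists n; apply: tn => /=.
Qed.

(** Phases of duration 0 are skipped by taking the least candidate. *)
Definition phase t := ex_minn (phase_end_gt t).

Lemma phaseP t :
  [/\ (0 < phase t)%N, (phase_end dur (phase t).-1 <= t)%N
    & (t < phase_end dur (phase t))%N].
Proof.
rewrite /phase; case: ex_minnP => [[|n]]; first by rewrite phase_end0.
move=> tn nmin; split=> //=; rewrite leqNgt; apply/negP => /nmin.
by rewrite ltnn.
Qed.

Lemma phaseE k t : (phase_end dur k.-1 <= t < phase_end dur k)%N -> phase t = k.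
Proof.
move=> /andP[kt tk]; have [p0 pt tp] := phaseP t.
case: (ltngtP (phase t) k) => //.
  case: k kt tk => // k kt _; rewrite ltnS => /leq_phase_end => h.
  by have := leq_trans tp (leq_trans h kt); rewrite ltnn.
case: (phase t) p0 pt tp => // p _ pt _; rewrite ltnS => /leq_phase_end => h.
by have := leq_trans tk (leq_trans h pt); rewrite ltnn.
Qed.

Lemma phase_le k t : (t < phase_end dur k)%N -> (phase t <= k)%N.
Proof. by rewrite /phase; case: ex_minnP => n _; apply. Qed.

Lemma leq_phase s t : (s <= t)%N -> (phase s <= phase t)%N.
Proof. by have [_ _ tp] := phaseP t => st; apply/phase_le/(leq_ltn_trans st). Qed.

End Phases.

(** * The law of the walk *)

(** If disjoint pieces of an event [A] exhaust its probability, the rest of [A] is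
    a null event and can be ignored when [A] is cut by another event. *)
Lemma measure_refine (R : realType) d (T : measurableType d)
    (P : probability T R) n (A C : set T) (B : 'I_n -> set T) :
  measurable A -> measurable C -> (forall i, measurable (B i)) ->
  (forall i, B i `<=` A) -> trivIset setT B ->
  (\sum_(i < n) P (B i) = P A)%E ->
  P (A `&` C) = (\sum_(i < n) P (B i `&` C))%E.
Proof.
move=> mA mC mB BA tB BE; set D := \big[setU/set0]_(i < n) B i.
have mD : measurable D by exact: bigsetU_measurable.
have DA : D `<=` A by apply: (big_ind (fun E => E `<=` A)) => // E F EA FA w [/EA|/FA].
have PD : P D = P A by rewrite -BE measure_bigsetU_ord.
have PAD : P (A `\` D) = 0%E.
  have finA : P A \is a fin_num by exact: fin_num_measure.
  rewrite measureD// => [|]; last by rewrite -ge0_fin_numE.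
  by rewrite setIidr// [X in (_ - X)%E]PD subee.
have -> : P (A `&` C) = (P ((A `&` C) `\` D) + P (A `&` C `&` D))%E.
  exact: measureDI (measurableI _ _ mA mC) mD.
rewrite (_ : P ((A `&` C) `\` D) = 0%E); last first.
  apply: (subset_measure0 (B := A `\` D)) => //; try exact: measurableD.
    by apply: measurableD => //; exact: measurableI.
  by move=> w [[Aw _] nDw].
rewrite add0e setIAC (setIidr DA) /D big_distrl/=.
rewrite measure_bigsetU_ord// => [i|]; first exact: measurableI.
by apply/trivIsetP => i j _ _ ij; rewrite setIACA (trivIsetP.1 tB)// set0I.
Qed.

Lemma cubeP n (u : nat -> bool) :
  cube n u <-> forall i, (n <= i)%N -> u i = false.
Proof.
split=> [cu i|un]; first exact: cube_default.
exists [tuple u i | i < n] => //; apply/funext => i; rewrite /pad.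
have [ni|ni] := ltnP i n; last by rewrite nth_default ?size_tuple// un.
by rewrite -[i]/(nat_of_ord (Ordinal ni)) -tnth_nth tnth_mktuple.
Qed.

Lemma cube_flip_coord n u (i : 'I_n) : cube n u -> cube n (flip_coord u i).
Proof.
move=> /cubeP un; apply/cubeP => j nj.
by rewrite /flip_coord un// gtn_eqF// (leq_trans (ltn_ord i)).
Qed.

Lemma flip_coord_inj u : injective (flip_coord u).
Proof.
move=> i j /(congr1 (@^~ i)); rewrite /flip_coord eqxx => /addbI/esym.
by move/eqP.
Qed.

Lemma cube_trans_flip (R : realType) n u (i : 'I_n) :
  cube_trans R n u (flip_coord u i) = n%:R^-1.
Proof.
rewrite /cube_trans (_ : l1dist _ _ _ = 1%N)// /l1dist (bigD1 i)//=.
rewrite big1 ?addn0 => [|j ji]; rewrite /flip_coord ?eqxx; first by case: (u i).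
by rewrite (negbTE (_ : (j != i :> nat))) ?addbF ?distnn.
Qed.

Section WalkLaw.
Context {R : realType} {dur : nat -> nat}
  {dur_infty : phase_end dur n @[n --> \oo] --> \oo}
  {d : measure_display} {Omega : measurableType d}
  {Pr : probability Omega R} {X : nat -> Omega -> (nat -> bool)}.
Hypothesis X_walk : is_walk (cube_rwogg R dur_infty) cube_origin Pr X.

Let mX t u : measurable (X t @^-1` [set u]).
Proof. exact: (walk_measurable X_walk). Qed.

Let phase := phase dur_infty.

Lemma measurable_trajectory t x : measurable (trajectory X t x).
Proof.
rewrite (_ : trajectory X t x = \bigcap_(i < t.+1) X i @^-1` [set x i]).
  by apply: fin_bigcap_measurable => // i _; exact: mX.
by apply/seteqP; split=> w Hw i; have := Hw i; rewrite /= ltnS.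
Qed.

(** Induction on the number [k] of remaining steps, for all pasts [x] at once: the
    past splits according to the neighbour of [x t] reached at time [t.+1].
    These [n] pieces carry all the probability of the past, so that nothing has
    to be known about the trajectories that leave the cubes. *)
Lemma return_from_trajectory k t x : cube (phase t) (x t) ->
  Pr (trajectory X t x `&` X (t + k)%N @^-1` [set cube_origin]) =
  (Pr (trajectory X t x)
   * (return_from [seq phase s | s <- iota t k] (x t))%:E)%E.
Proof.
elim: k t x => [|k IH] t x cxt /=.
  rewrite addn0; case: eqP => [xt0|xt0].
    by rewrite mule1 setIidl// => w xw; rewrite /= xw.
  rewrite mule0 (_ : _ `&` _ = set0) ?measure0// -subset0.
  by move=> w [xw /= Xw]; apply: xt0; rewrite -Xw xw.
have [p0 pt tp] := phaseP dur_infty t.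
set n := phase t in cxt *.
pose y (i : 'I_n) s := if s == t.+1 then flip_coord (x t) i else x s.
have yS i : y i t.+1 = flip_coord (x t) i by rewrite /y eqxx.
have yE i s : (s <= t)%N -> y i s = x s.
  by move=> st; rewrite /y ltn_eqF// ltnS.
pose B i := trajectory X t.+1 (y i).
have BA i : B i `<=` trajectory X t x.
  by move=> w Bw s st; rewrite Bw ?yE// leqW.
have PB i : Pr (B i) = (Pr (trajectory X t x) * (n%:R^-1)%:E)%E.
  rewrite (walk_step X_walk (n := n))//=; first last.
  - by rewrite yS; exact: cube_flip_coord.
  - by rewrite yE.
  - by rewrite pt.
  rewrite yS yE// cube_trans_flip; congr (Pr _ * _)%E.
  by apply/seteqP; split=> w Hw s st; rewrite Hw ?yE.
rewrite (measure_refine (B := B)).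
- have PI i : Pr (B i `&` X (t + k.+1)%N @^-1` [set cube_origin]) =
      (Pr (trajectory X t x) * (n%:R^-1 *
        return_from [seq phase s | s <- iota t.+1 k] (flip_coord (x t) i))%:E)%E.
    rewrite -addSnnS IH; last first.
      rewrite yS; apply/cubeP => j pj; move/cubeP: (cube_flip_coord i cxt); apply.
      exact: leq_trans (leq_phase dur_infty (leqnSn t)) pj.
    by rewrite PB yS EFinM muleA.
  rewrite (eq_bigr _ (fun i _ => PI i)).
  rewrite -ge0_sume_distrr => [|i _]; last first.
    by rewrite lee_fin mulr_ge0 ?invr_ge0 ?return_from_ge0.
  by rewrite sumEFin mulr_sumr.
- exact: measurable_trajectory.
- exact: mX.
- by move=> i; exact: measurable_trajectory.
- exact: BA.
- apply/trivIsetP => i j _ _ ij; rewrite -subset0 => w [Biw Bjw].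
  have := Biw t.+1 (leqnn _); rewrite Bjw// !yS => /flip_coord_inj.
  by move/val_inj => ji; rewrite ji eqxx in ij.
- rewrite (eq_bigr _ (fun i _ => PB i)).
  rewrite -ge0_sume_distrr => [|i _]; last by rewrite lee_fin invr_ge0.
  rewrite sumEFin sumr_const card_ord -[_ *+ n]mulr_natr mulVf ?mule1//.
  by rewrite pnatr_eq0 -lt0n.
Qed.

Lemma return_probE t : return_prob Pr X cube_origin t =
  (return_from [seq phase s | s <- iota 0 t] cube_origin)%:E.
Proof.
have := @return_from_trajectory t 0 (fun=> cube_origin).
rewrite add0n (_ : trajectory _ _ _ = X 0%N @^-1` [set cube_origin]); last first.
  apply/seteqP; split=> w /=; first by move=> Xw; exact: (Xw 0%N).
  by move=> Xw i; rewrite leqn0 => /eqP ->.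
rewrite (walk_start X_walk) mul1e => <-; last exact/cubeP.
rewrite /return_prob; set At := X t @^-1` _; set A0 := X 0%N @^-1` _.
have -> : Pr At = (Pr (At `\` A0) + Pr (At `&` A0))%E.
  exact: measureDI (mX _ _) (mX _ _).
rewrite setIC.
rewrite (_ : Pr (_ `\` _) = 0%E) ?add0e//.
apply: (subset_measure0 (B := ~` (X 0%N @^-1` [set cube_origin]))) => //.
- by apply: measurableD; exact: mX.
- by apply: measurableC; exact: mX.
- transitivity (1 - Pr A0)%E; first exact: probability_setC.
  by rewrite (walk_start X_walk) subee.
Qed.

End WalkLaw.

(** * Elementary inequalities *)

Lemma prod_le_mean_pow (R : realFieldType) n (x : 'I_n -> R) :
  (0 < n)%N -> (forall i, 0 <= x i) ->
  \prod_(i < n) x i <= (\sum_(i < n) x i ^+ n) / n%:R.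
Proof.
move=> n0 x0; have xn0 i : 0 <= x i ^+ n by exact: exprn_ge0.
rewrite -(@ler_pXn2r _ n)// ?nnegrE ?prodr_ge0//; last first.
  by rewrite mulr_ge0 ?invr_ge0 ?ler0n// sumr_ge0.
have [+ _] := @leif_AGM R 'I_n predT (fun i => x i ^+ n) (fun i _ => xn0 i).
by rewrite prodrXl card_ord.
Qed.

Lemma sum_geometric_le (R : realFieldType) (a q : R) d :
  0 <= a -> a <= 1 - q^-1 -> 0 < q -> \sum_(j < d) a ^+ j <= q.
Proof.
move=> a0 aq q0; have aq1 : q^-1 <= 1 - a by rewrite lerBrDr -lerBrDl.
have S0 : 0 <= \sum_(j < d) a ^+ j by apply: sumr_ge0 => j _; exact: exprn_ge0.
rewrite -[leRHS]mul1r -ler_pdivrMr//.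
apply: (@le_trans _ _ ((1 - a) * \sum_(j < d) a ^+ j)).
  by rewrite mulrC ler_wpM2r.
by rewrite -opprB mulNr -subrX1 opprB gerBl exprn_ge0.
Qed.

(** Bernoulli gives (1 + 1/k)^k >= 2, and (1 - 1/k)(1 + 1/k) <= 1, so each block
    of [k] factors is at most 1/2. *)
Lemma expr_half_bound (R : realFieldType) k m : (0 < k)%N -> (k ^ 2 <= m)%N ->
  (1 - k%:R^-1 : R) ^+ m <= 2^-1 ^+ k.
Proof.
move=> k0 km; have kR : 1 <= k%:R :> R by rewrite ler1n.
have q0 : 0 <= (1 - k%:R^-1 : R) by rewrite subr_ge0 invf_le1// (lt_le_trans ltr01).
have q1 : (1 - k%:R^-1 : R) <= 1 by rewrite gerBl invr_ge0 ler0n.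
apply: (le_trans (ler_wiXn2l q0 q1 km)).
rewrite -mulnn exprM lerXn2r ?nnegrE ?exprn_ge0// ?invr_ge0//.
have bernoulli n : 1 + n%:R / k%:R <= (1 + k%:R^-1 : R) ^+ n.
  elim: n => [|n IH]; first by rewrite mul0r addr0 expr0.
  have i0 : 0 <= k%:R^-1 :> R by rewrite invr_ge0 ler0n.
  rewrite exprS; apply: (@le_trans _ _ ((1 + k%:R^-1) * (1 + n%:R / k%:R))).
    have : 0 <= (n%:R / k%:R / k%:R : R) by rewrite !mulr_ge0 ?invr_ge0 ?ler0n.
    by rewrite -natr1; lra.
  by rewrite ler_wpM2l// addr_ge0.
have b := bernoulli k; rewrite divff ?pnatr_eq0 -?lt0n// in b.
rewrite -[leRHS]mul1r ler_pdivlMr ?ltr0n//.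
apply: (@le_trans _ _ ((1 - k%:R^-1) ^+ k * (1 + k%:R^-1) ^+ k)).
  by rewrite ler_wpM2l ?exprn_ge0// (le_trans _ b)// -natr1.
rewrite -exprMn; apply: exprn_ile1.
  by rewrite mulr_ge0// addr_ge0 ?invr_ge0 ?ler0n.
rewrite -subr_sqr expr1n gerBl; exact: sqr_ge0.
Qed.

Lemma leq_count_even a d :
  (d <= (\sum_(i < d) ~~ odd (a + i)).*2.+1)%N.
Proof.
(* the exact count makes the induction go through *)
suff : ((\sum_(i < d) ~~ odd (a + i)).*2 + ~~ odd (a + d) = d + ~~ odd a)%N.
  by case: (~~ odd (a + d)); case: (~~ odd a); lia.
elim: d => [|d IH]; first by rewrite big_ord0 addn0.
rewrite big_ord_recr /= addnS /= negbK.
by move: IH; case: (odd (a + d)) => /=; lia.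
Qed.

Lemma sum_phases (R : realType) (dur : nat -> nat) (f : nat -> R) n :
  \sum_(t < phase_end dur n) f t =
  \sum_(1 <= k < n.+1) \sum_(i < dur k) f (phase_end dur k.-1 + i)%N.
Proof.
elim: n => [|n IH]; first by rewrite phase_end0 big_ord0 big_geq.
by rewrite big_nat_recr//= -IH phase_endS big_split_ord.
Qed.

(** * Bounds on the return probabilities *)

Section Estimates.
Context {R : realType} {dur : nat -> nat}.
Hypothesis dur_infty : phase_end dur n @[n --> \oo] --> \oo.
Implicit Types (k t m i j N : nat) (e : nat -> bool).

Let phase := phase dur_infty.
Let T := phase_end dur.

Definition return_at t : R :=
  return_from [seq phase s | s <- iota 0 t] cube_origin.

Lemma return_at_ge0 t : 0 <= return_at t.
Proof. exact: return_from_ge0. Qed.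

Lemma return_atE N t : (forall s, (s < t)%N -> (phase s <= N)%N) ->
  return_at t = mean N (fun e => \prod_(s < t) bias (phase s) e).
Proof.
move=> phN; rewrite /return_at (@return_from_mean _ N)//; last first.
  by apply/allP => n /mapP[s]; rewrite mem_iota => /andP[_ st] ->; exact: phN.
apply: eq_mean => e; rewrite big1 ?mul1r ?big_map => [|i _]; last first.
  by rewrite andbF expr0.
by rewrite -[in iota _ _](subn0 t) big_mkord.
Qed.

(** The eigenvalues have modulus at most 1, so any window of [m] consecutive
    steps already bounds the return probability. *)
Lemma return_at_le_prod t m j (N := phase (t + m + j)) :
  return_at (t + m + j)%N <=
  mean N (fun e => \prod_(i < m) `|bias (phase (t + i)) e : R|).
Proof.
rewrite (@return_atE N) => [|s /ltnW /leq_phase]; last exact.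
apply: mean_le => e; apply: le_trans (ler_norm _) _; rewrite normr_prod.
rewrite big_split_ord big_split_ord /= -[leRHS]mul1r -[leRHS]mulr1.
have le1 (I : finType) (F : I -> nat) :
    0 <= \prod_i `|bias (F i) e : R| <= 1.
  by apply/andP; split; [exact: prodr_ge0 |
    apply: prodr_ile1 => i _; rewrite normr_ge0 bias_le1].
have /andP[? ?] := le1 _ (fun i : 'I_t => phase i).
have /andP[? ?] := le1 _ (fun i : 'I_m => phase (t + i)).
have /andP[? ?] := le1 _ (fun i : 'I_j => phase (t + m + i)).
by apply: ler_pM => //; [exact: mulr_ge0 | exact: ler_pM].
Qed.

(** By the arithmetic-geometric inequality the product of the last six
    eigenvalues is at most the mean of their sixth powers; this decouples steps
    made in cubes of different dimensions. *)
Lemma return_at_le_cube k t : (0 < k)%N -> (k <= phase t)%N ->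
  return_at (t + 6)%N <= 15 / k%:R ^+ 3.
Proof.
move=> k0 kt; rewrite -(addn0 (t + 6)%N).
apply: (le_trans (return_at_le_prod t 6 0)); rewrite addn0.
set N := phase _.
have k0R : 0 < k%:R :> R by rewrite ltr0n.
apply: (@le_trans _ _ (mean N (fun e =>
    6^-1 * \sum_(i < 6) bias (phase (t + i)) e ^+ 6))).
  apply: mean_le => e; rewrite mulrC.
  apply: (le_trans (prod_le_mean_pow (isT : (0 < 6)%N) _)) => //.
  rewrite ler_wpM2r// ler_sum// => i _.
  by rewrite -normrX ger0_norm// exprn_even_ge0.
rewrite meanZ mean_sum mulrC ler_pdivrMr//.
apply: (@le_trans _ _ (\sum_(i < 6) (15 / k%:R ^+ 3))); last first.
  by rewrite sumr_const card_ord mulr_natr.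
apply: ler_sum => i _; have ki : (k <= phase (t + i))%N.
  exact: leq_trans kt (leq_phase _ (leq_addr _ _)).
apply: (le_trans (mean_bias6 _ _)).
- exact: leq_trans k0 ki.
- by apply: leq_phase; rewrite leq_add2l ltnW.
- rewrite ler_pM2l// lef_pV2 ?posrE ?exprn_gt0 ?ltr0n ?(leq_trans k0 ki)//.
  by rewrite lerXn2r ?nnegrE ?ler0n// ler_nat.
Qed.

Lemma phase_block k i : (0 < k)%N -> (i < dur k)%N -> phase (T k.-1 + i)%N = k.
Proof.
case: k => // k _ ik; apply: phaseE; rewrite leq_addr/= phase_endS.
by rewrite ltn_add2l.
Qed.

Lemma return_at_le_bias k m j : (0 < k)%N -> (m <= dur k)%N ->
  return_at (T k.-1 + m + j)%N <= mean k (fun e => `|bias k e : R| ^+ m).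
Proof.
move=> k0 mk; case: m mk => [_|m mk].
  under eq_mean do rewrite expr0; rewrite mean_cst.
  apply: (le_trans (return_at_le_prod _ 0 _)).
  by under eq_mean do rewrite big_ord0; rewrite mean_cst.
apply: (le_trans (return_at_le_prod _ _ _)).
set N := phase _; have kN : (k <= N)%N.
  rewrite -(@phase_block k 0) ?(leq_ltn_trans _ mk)// addn0.
  by apply: leq_phase; rewrite -addnA leq_addr.
rewrite -(@mean_local _ k N)// => [|e e' ee']; last first.
  by rewrite /bias (signsum_local ee').
apply: mean_le => e.
rewrite (eq_bigr (fun=> `|bias k e : R|)) ?prodr_const ?card_ord// => i _.
by rewrite phase_block// (leq_trans (ltn_ord i)).
Qed.

(** The shift by 6 guarantees six steps in dimension at least [k] even for the
    first times of the phase, where no decay is available inside the phase. *)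
Lemma block_upper k : (0 < k)%N ->
  \sum_(i < dur k) return_at (T k.-1 + i + 6)%N <=
  105 / k%:R ^+ 2 + 2 * ((dur k)%:R / 2 ^+ k).
Proof.
move=> k0; have k1R : 1 <= k%:R :> R by rewrite ler1n.
have k0R : 0 < k%:R :> R by rewrite ltr0n.
have early i : (i < dur k)%N ->
    return_at (T k.-1 + i + 6)%N <= 15 / k%:R ^+ 3.
  by move=> ik; apply: return_at_le_cube; rewrite ?phase_block.
have cube_le : 90 / k%:R ^+ 3 <= 90 / k%:R ^+ 2 :> R.
  by rewrite ler_pM2l// lef_pV2 ?posrE ?exprn_gt0// ler_weXn2l.
have pow0 : 0 <= 2 * ((dur k)%:R / 2 ^+ k) :> R by rewrite !mulr_ge0// invr_ge0 exprn_ge0.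
have sq0 : 0 <= 15 / k%:R ^+ 2 :> R by rewrite mulr_ge0// invr_ge0 exprn_ge0// ltW.
(* a phase of at most six steps is covered by the cubic bound alone *)
have [dk|dk] := leqP (dur k) 6.
  apply: (@le_trans _ _ (\sum_(i < dur k) (15 / k%:R ^+ 3))).
    by apply: ler_sum => i _; exact: early.
  apply: (@le_trans _ _ (6 * (15 / k%:R ^+ 3))); last by move: cube_le; lra.
  rewrite sumr_const card_ord -[leLHS]mulr_natl ler_wpM2r ?ler_nat//.
rewrite -(subnKC (ltnW dk)); set d' := (dur k - 6)%N; rewrite big_split_ord /=.
have first_six : \sum_(i < 6) return_at (T k.-1 + i + 6)%N <= 6 * (15 / k%:R ^+ 3).
  rewrite mulr_natl -[X in _ *+ X](card_ord 6) -sumr_const.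
  by apply: ler_sum => i _; apply: early; exact: ltn_trans dk.
have d'k : d'%:R / 2 ^+ k <= (dur k)%:R / 2 ^+ k :> R.
  by rewrite ler_wpM2r ?invr_ge0 ?exprn_ge0// ler_nat leq_subr.
have later : \sum_(i < d') return_at (T k.-1 + (6 + i) + 6)%N <=
    15 / k%:R ^+ 2 + 2 * (d'%:R / 2 ^+ k).
  apply: (@le_trans _ _ (mean k (fun e =>
      \sum_(i < d') `|bias k e : R| ^+ (6 + i)))).
    rewrite mean_sum; apply: ler_sum => i _; apply: return_at_le_bias => //.
    by rewrite -(subnKC (ltnW dk)) leq_add2l ltnW.
  apply: (@le_trans _ _ (mean k (fun e => k%:R * bias k e ^+ 6 +
      (d'%:R * (constant_at false k e)%:R + d'%:R * (constant_at true k e)%:R)))).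
    apply: mean_le => e; have b6 : 0 <= bias k e ^+ 6 :> R by exact: exprn_even_ge0.
    have kb6 : 0 <= k%:R * bias k e ^+ 6 :> R by rewrite mulr_ge0// ltW.
    have le_d : \sum_(i < d') `|bias k e : R| ^+ (6 + i) <= d'%:R.
      rewrite -[leRHS]mulr1 mulr_natl -[X in _ *+ X](card_ord d') -sumr_const.
      by apply: ler_sum => i _; rewrite exprn_ile1// bias_le1.
    have dd (b : bool) : 0 <= d'%:R * b%:R :> R by rewrite mulr_ge0.
    case: (boolP (constant_at false k e)) => [_|nF].
      by rewrite mulr1; have := dd (constant_at true k e); lra.
    case: (boolP (constant_at true k e)) => [_|nT]; first by rewrite mulr1 mulr0; lra.
    rewrite !mulr0 !addr0; under eq_bigr do rewrite exprD.
    rewrite -mulr_sumr -normrX ger0_norm// mulrC ler_wpM2r//.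
    exact: sum_geometric_le (bias_mixed nF nT) _.
  rewrite !meanD !meanZ !mean_constant//.
  have := @mean_bias6 R _ _ k0 (leqnn k); rewrite -(ler_pM2l k0R).
  have -> : k%:R * (15 / k%:R ^+ 3) = 15 / k%:R ^+ 2 :> R by field; rewrite gt_eqF.
  by rewrite exprVn; lra.
by rewrite subnKC 1?ltnW//; move: first_six later cube_le d'k; lra.
Qed.

(** At an even time the two constant characters contribute exactly 1 each on
    events of probability 2^-k, because they are constant on the smaller cubes as
    well; the mixed ones can cancel at most one of the two contributions. *)
Lemma return_at_ge k m : (0 < k)%N -> (m <= dur k)%N -> (k ^ 2 <= m)%N ->
  ~~ odd (T k.-1 + m) -> 2^-1 ^+ k <= return_at (T k.-1 + m)%N.
Proof.
move=> k0 mk km ev.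
have phk s : (s < T k.-1 + m)%N -> (phase s <= k)%N.
  move=> sm; apply: phase_le; apply: (leq_trans sm).
  by case: k k0 mk {km ev sm} => // k _ mk; rewrite phase_endS leq_add2l.
rewrite (return_atE phk).
apply: (@le_trans _ _ (mean k (fun e => (constant_at false k e)%:R
   + ((constant_at true k e)%:R + - (1 - k%:R^-1 : R) ^+ m)))).
  rewrite !meanD !mean_constant// mean_cst lerDl subr_ge0.
  exact: expr_half_bound.
have kR : 1 <= k%:R :> R by rewrite ler1n.
have q0 : 0 <= (1 - k%:R^-1 : R) by rewrite subr_ge0 invf_le1// (lt_le_trans ltr01).
have Q0 := exprn_ge0 m q0.
apply: mean_le => e.
have cst b : constant_at b k e ->
    \prod_(s < T k.-1 + m) bias (phase s) e = 1 :> R.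
  move=> /forallP eb.
  rewrite (eq_bigr (fun=> (-1) ^+ b)) => [|s _].
    by rewrite prodr_const card_ord -exprM mulnC exprM -signr_odd (negbTE ev) expr0 expr1n.
  have [p0 _ _] := phaseP dur_infty s.
  rewrite (@bias_constant _ b)//; apply/forallP => i.
  exact: (eb (widen_ord (phk s (ltn_ord s)) i)).
have excl : constant_at false k e -> constant_at true k e -> False.
  by move=> /forallP/(_ (Ordinal k0))/eqP/= e0 /forallP/(_ (Ordinal k0)); rewrite /= e0.
case: (boolP (constant_at false k e)) => [cF|ncF].
  case: (boolP (constant_at true k e)) => [/(excl cF)//|_].
  by rewrite (cst _ cF) add0r gerDl oppr_le0.
case: (boolP (constant_at true k e)) => [cT|ncT].
  by rewrite (cst _ cT) add0r gerDl oppr_le0.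
rewrite !add0r lerNl; apply: le_trans (ler_norm _) _.
rewrite normrN normr_prod big_split_ord /= -[leRHS]mul1r.
apply: ler_pM; rewrite ?prodr_ge0//.
  by apply: prodr_ile1 => i _; rewrite normr_ge0 bias_le1.
rewrite -[X in _ <= _ ^+ X](card_ord m) -prodr_const.
apply: ler_prod => i _; rewrite normr_ge0 phase_block//; first exact: bias_mixed.
exact: leq_trans mk.
Qed.

(** Half of the times are even, up to one, and the first [k ^ 2] ones are given
    up. *)
Lemma block_lower k : (0 < k)%N ->
  (dur k)%:R / 2 ^+ k <=
  2 * \sum_(i < dur k) return_at (T k.-1 + i).+1
  + (2 * k%:R ^+ 2 + 1) / 2 ^+ k.
Proof.
move=> k0; have p0 : 0 <= (2 ^+ k)^-1 :> R by rewrite invr_ge0 exprn_ge0.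
have low i : (i < dur k)%N ->
    (2 ^+ k)^-1 * ((~~ odd ((T k.-1).+1 + i))%:R - (i < k ^ 2)%:R) <=
    return_at (T k.-1 + i).+1.
  move=> ik; rewrite addSn; case: (boolP (~~ odd _)) => ev /=; last first.
    by rewrite (le_trans _ (return_at_ge0 _))// mulr_ge0_le0// sub0r oppr_le0.
  have [_|ki] := ltnP; first by rewrite subrr mulr0 return_at_ge0.
  rewrite subr0 mulr1 -exprVn -addnS.
  by apply: return_at_ge; rewrite ?addnS//; exact: leqW.
have sum_low := ler_sum (index_enum 'I_(dur k)) (fun (i : 'I_(dur k)) (_ : true) => low i (ltn_ord i)).
rewrite -mulr_sumr sumrB -!natr_sum in sum_low.
have cnt : (dur k)%:R <= 2 * (\sum_(i < dur k) ~~ odd ((T k.-1).+1 + i))%N%:R + 1 :> R.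
  rewrite -natrM natr1 ler_nat mul2n; exact: leq_count_even.
have few : (\sum_(i < dur k) (i < k ^ 2))%N%:R <= k%:R ^+ 2 :> R.
  rewrite -natrX ler_nat.
  suff -> : (\sum_(i < dur k) (i < k ^ 2) = minn (dur k) (k ^ 2))%N by exact: geq_minr.
  elim: (dur k) => [|n IH]; first by rewrite big_ord0 min0n.
  by rewrite big_ord_recr /= IH; case: ltnP; lia.
have cnt' := ler_wpM2l p0 cnt; have few' := ler_wpM2l p0 few.
by move: sum_low cnt' few'; lra.
Qed.

End Estimates.

(** * Summation over the phases *)

Lemma sum_inv_square_le (R : realFieldType) n :
  \sum_(1 <= k < n.+1) (k%:R ^+ 2)^-1 <= 2 :> R.
Proof.
case: n => [|n]; first by rewrite big_geq.
suff : \sum_(1 <= k < n.+2) (k%:R ^+ 2)^-1 <= 2 - n.+1%:R^-1 :> R.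
  by move/le_trans; apply; rewrite gerBl.
elim: n => [|n IH]; first by rewrite big_nat1 expr1n invr1; lra.
rewrite big_nat_recr//= -lerBrDr; apply: (le_trans IH).
rewrite -[leRHS]addrA -opprD lerD2l lerN2.
rewrite -[n.+2%:R]natr1; set x : R := n.+1%:R.
have x0 : 0 < x by rewrite ltr0n.
have x10 : 0 < x + 1 by rewrite addr_gt0.
rewrite -subr_ge0 (_ : _ - _ = (x * (x + 1) ^+ 2)^-1); last first.
  by field; rewrite !gt_eqF.
by rewrite invr_ge0 mulr_ge0 ?exprn_ge0// ltW.
Qed.

Lemma sum_square_geometric_le (R : realFieldType) n :
  \sum_(1 <= k < n.+1) (2 * k%:R ^+ 2 + 1) / 2 ^+ k <= 13 :> R.
Proof.
have -> : \sum_(1 <= k < n.+1) (2 * k%:R ^+ 2 + 1) / 2 ^+ k =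
    13 - (2 * n%:R ^+ 2 + 8 * n%:R + 13) / 2 ^+ n :> R.
  elim: n => [|n IH]; first by rewrite big_geq// expr0; field.
  rewrite big_nat_recr//= IH -[n.+1%:R]natr1 (exprS 2 n); field.
  by rewrite expf_neq0.
by rewrite gerBl mulr_ge0// ?invr_ge0 ?exprn_ge0// !addr_ge0// ?mulr_ge0// sqr_ge0.
Qed.

(** Divergence is compared through partial sums whose ranges need not agree, since
    one series runs over times and the other over phases. *)
Lemma nneseries_pinfty_le (R : realType) (f g : nat -> R) (a b : R) :
  (forall n, 0 <= f n) -> (forall n, 0 <= g n) -> 0 <= a ->
  (forall m, exists n,
    \sum_(1 <= i < m) f i <= a * \sum_(1 <= i < n) g i + b) ->
  (\sum_(1 <= i <oo) (f i)%:E = +oo)%E -> (\sum_(1 <= i <oo) (g i)%:E = +oo)%E.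
Proof.
move=> f0 g0 a0 fg foo; apply: contrapT => goo.
have G0 : (0 <= \sum_(1 <= i <oo) (g i)%:E)%E.
  by apply: nneseries_ge0 => i _ _; rewrite lee_fin.
have Gfin : (\sum_(1 <= i <oo) (g i)%:E)%E \is a fin_num.
  by rewrite ge0_fin_numE// ltey; apply/eqP.
set G := fine (\sum_(1 <= i <oo) (g i)%:E)%E.
suff : (\sum_(1 <= i <oo) (f i)%:E <= (a * G + b)%:E)%E by rewrite foo.
apply: lime_le; first by apply: is_cvg_nneseries => i _ _; rewrite lee_fin.
apply: nearW => m; have [n fgm] := fg m.
rewrite sumEFin lee_fin (le_trans fgm)// lerD2r ler_wpM2l//.
rewrite -lee_fin fineK// -sumEFin.
by apply: nneseries_lim_ge => i _ _; rewrite lee_fin.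
Qed.

Theorem theorem5p9 (R : realType) (dur : nat -> nat)
    (dur_infty : phase_end dur n @[n --> \oo] --> \oo)
    (d : measure_display) (Omega : measurableType d)
    (Pr : probability Omega R) (X : nat -> Omega -> (nat -> bool))
    (X_walk : is_walk (cube_rwogg R dur_infty) cube_origin Pr X) :
  ((\sum_(1 <= n <oo) ((dur n)%:R / 2 ^+ n : R)%:E = +oo)%E ->
     recurrent Pr X cube_origin) /\
  (~ (\sum_(1 <= n <oo) ((dur n)%:R / 2 ^+ n : R)%:E = +oo)%E ->
     transient Pr X cube_origin).
Proof.
have r0 t : 0 <= return_at dur_infty t :> R by exact: return_at_ge0.
have d0 n : 0 <= (dur n)%:R / 2 ^+ n :> R.
  by rewrite mulr_ge0 ?invr_ge0 ?exprn_ge0.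
rewrite /transient /recurrent (eq_eseriesr (fun t _ => return_probE X_walk t)).
split=> [|doo roo]; last apply: doo.
  apply: (nneseries_pinfty_le (g := return_at dur_infty) (a := 2) (b := 13)) => // -[|n].
    by exists 0%N; rewrite !big_geq// mulr0 add0r.
  exists (phase_end dur n).+1; rewrite [in leRHS]big_add1 big_mkord /=.
  rewrite (sum_phases dur (fun t => return_at dur_infty t.+1)).
  apply: (@le_trans _ _ (\sum_(1 <= k < n.+1)
     (2 * (\sum_(i < dur k) return_at dur_infty (phase_end dur k.-1 + i).+1)
      + (2 * k%:R ^+ 2 + 1) / 2 ^+ k))).
    by apply: ler_sum_nat => k /andP[k0 _]; exact: block_lower.
  by rewrite big_split -mulr_sumr lerD2l sum_square_geometric_le.
move: roo; apply: (nneseries_pinfty_le (f := return_at dur_infty) (a := 2)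
    (b := \sum_(1 <= t < 6) return_at dur_infty t + 210)) => // m.
have [n mn] := phase_end_gt dur_infty m; exists n.+1.
apply: (@le_trans _ _ (\sum_(1 <= t < phase_end dur n + 6) return_at dur_infty t)).
  have [->|m0] := posnP m; first by rewrite big_geq// sumr_ge0.
  rewrite [leRHS](big_cat_nat (n := m))//= ?lerDl ?sumr_ge0//.
  by rewrite ltnW// ltn_addr.
rewrite (big_cat_nat (n := 6))//= ?leq_addl// [leRHS]addrCA lerD2l.
rewrite -{1}[6%N]add0n big_addn addnK big_mkord.
rewrite (sum_phases dur (fun t => return_at dur_infty (t + 6))).
apply: (@le_trans _ _ (\sum_(1 <= k < n.+1)
   (105 / k%:R ^+ 2 + 2 * ((dur k)%:R / 2 ^+ k)))).
  by apply: ler_sum_nat => k /andP[k0 _]; exact: block_upper.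
rewrite big_split -!mulr_sumr /=.
have := sum_inv_square_le R n; lra.
Qed.
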